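(* Let $n$ be a natural number. The category $\mathcal E_n$ of euclidean local orders of dimension $n$ and local embeddings is a coreflective subcategory of the category of local orders and weakly euclidean morphisms. In addition, $\mathcal E_n$ is coreflective in the category $\mathbb L_e$ of local orders and local embeddings.
   Context: An ordered space is a topological space with a partial order; a dihomeomorphism is an isomorphism of ordered spaces. An ordered base $\mathcal B$ of a topological space $X$ is a collection of posets whose underlying sets form a base of the topology of $X$ and such that for all $B,B'\in\mathcal B$ and $x\in B\cap B'$ there is $B''\in\mathcal B$ with $x\in B''\subseteq B\cap B'$ and $B''$ a subposet of both $B$ and $B'$. A locally ordered space (or local order) is a topological space equipped with an ordered base; elements of the base are called ordered open sets, and an ordered neighborhood of $x$ is an ordered open set containing $x$. Convention: open subsets of ordered open sets, with the induced order, are also regarded as ordered open sets. A morphism (resp. local embedding) of local orders $f:X\to Y$ is a continuous map such that for every $x\in X$ and every ordered neighborhood $V$ of $f(x)$ there is an ordered neighborhood $U$ of $x$ with $f(U)\subseteq V$ and $f|_U$ order preserving (resp. order preserving and admitting a continuous order preserving inverse on its image). A local order is euclidean of dimension $n$ if every point has an ordered neighborhood dihomeomorphic to $\mathbb R^n$ with the product topology and product order (the empty local order is euclidean). A morphism of local orders $f:X\to Y$ is weakly euclidean (for the fixed $n$) if for every euclidean local order $E$ of dimension $n$ and every local embedding $g:E\to X$, the composite $f\circ g$ is a local embedding. A subcategory is coreflective if it is full and the inclusion functor has a right adjoint. *)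

(* Defs.v *)
From HB Require Import structures.
From mathcomp Require Import all_boot all_order all_algebra.
From mathcomp Require Import all_classical all_reals all_analysis.
Import Order.TTheory GRing.Theory Num.Theory.
Import numFieldNormedType.Exports.

Set Implicit Arguments.
Unset Strict Implicit.
Unset Printing Implicit Defensive.

Local Open Scope classical_set_scope.

Record category := Category {
  obj :> Type;
  hom : obj -> obj -> Type;
  idm : forall x, hom x x;
  comp : forall x y z, hom y z -> hom x y -> hom x z;
  comp_idl : forall x y (f : hom x y), comp (idm y) f = f;
  comp_idr : forall x y (f : hom x y), comp f (idm x) = f;
  comp_assoc : forall x y z t (h : hom z t) (g : hom y z) (f : hom x y),
    comp h (comp g f) = comp (comp h g) f }.

Arguments idm {c} x.
Arguments comp {c x y z}.

Record functor (C D : category) := Functor {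
  fobj :> C -> D;
  fmap : forall x y : C, hom x y -> hom (fobj x) (fobj y);
  fmap_id : forall x : C, fmap (idm x) = idm (fobj x);
  fmap_comp : forall (x y z : C) (g : hom y z) (f : hom x y),
    fmap (comp g f) = comp (fmap g) (fmap f) }.

Arguments fmap {C D} F {x y} : rename.

Definition full (C D : category) (F : functor C D) : Prop :=
  forall (x y : C) (g : hom (F x) (F y)), exists f : hom x y, fmap F f = g.

Record adjunction (C D : category) (F : functor C D) (G : functor D C) :=
  Adjunction {
    transpose : forall (c : C) (d : D), hom (F c) d -> hom c (G d);
    transpose_bij : forall c d, bijective (@transpose c d);
    transpose_nat : forall (c c' : C) (d d' : D)
      (h : hom c' c) (u : hom (F c) d) (k : hom d d'),
      transpose (comp k (comp u (fmap F h))) =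
      comp (fmap G k) (comp (transpose u) h) }.

Definition has_right_adjoint (C D : category) (F : functor C D) : Prop :=
  exists G : functor D C, inhabited (adjunction F G).

Record subcategory (C : category) := Subcategory {
  sub_obj : C -> Prop;
  sub_hom : forall x y : C, hom x y -> Prop;
  sub_idm : forall x, sub_obj x -> sub_hom (idm x);
  sub_comp : forall x y z (g : hom y z) (f : hom x y),
    sub_obj x -> sub_obj y -> sub_obj z ->
    sub_hom g -> sub_hom f -> sub_hom (comp g f) }.

Arguments sub_hom {C} s {x y}.

Lemma sig_eq (T : Type) (P : T -> Prop) (u v : {x : T | P x}) :
  sval u = sval v -> u = v.
Proof.
case: u v => [x Px] [y Py] /= xy; subst y.
by congr exist; apply: Prop_irrelevance.
Qed.

Section SubcategoryCategory.
Variables (C : category) (S : subcategory C).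

Definition subcat_ob := {x : C | sub_obj S x}.
Definition subcat_mor (x y : subcat_ob) :=
  {f : hom (sval x) (sval y) | sub_hom S f}.
Definition subcat_mor_id (x : subcat_ob) : subcat_mor x x :=
  exist _ (idm (sval x)) (sub_idm (svalP x)).
Definition subcat_mor_comp (x y z : subcat_ob) (g : subcat_mor y z)
    (f : subcat_mor x y) : subcat_mor x z :=
  exist _ (comp (sval g) (sval f))
    (sub_comp (svalP x) (svalP y) (svalP z) (svalP g) (svalP f)).

Lemma subcat_mor_idl (x y : subcat_ob) (f : subcat_mor x y) :
  subcat_mor_comp (subcat_mor_id y) f = f.
Proof. by apply: sig_eq; apply: comp_idl. Qed.

Lemma subcat_mor_idr (x y : subcat_ob) (f : subcat_mor x y) :
  subcat_mor_comp f (subcat_mor_id x) = f.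
Proof. by apply: sig_eq; apply: comp_idr. Qed.

Lemma subcat_mor_assoc (x y z t : subcat_ob) (h : subcat_mor z t)
    (g : subcat_mor y z) (f : subcat_mor x y) :
  subcat_mor_comp h (subcat_mor_comp g f) = subcat_mor_comp (subcat_mor_comp h g) f.
Proof. by apply: sig_eq; apply: comp_assoc. Qed.

Definition subcat : category :=
  @Category subcat_ob subcat_mor subcat_mor_id subcat_mor_comp
    subcat_mor_idl subcat_mor_idr subcat_mor_assoc.
End SubcategoryCategory.

Definition subcat_le (C : category) (S T : subcategory C) : Prop :=
  (forall x, sub_obj S x -> sub_obj T x) /\
  (forall (x y : C) (f : hom x y), sub_obj S x -> sub_obj S y ->
    sub_hom S f -> sub_hom T f).

Section Inclusion.
Variables (C : category) (S T : subcategory C) (ST : subcat_le S T).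

Definition incl_iobj (x : subcat S) : subcat T :=
  exist _ (sval x) (ST.1 _ (svalP x)).
Definition incl_imap (x y : subcat S) (f : hom x y) :
    hom (incl_iobj x) (incl_iobj y) :=
  exist _ (sval f) (ST.2 _ _ _ (svalP x) (svalP y) (svalP f)).

Lemma incl_imap_id (x : subcat S) : incl_imap (idm x) = idm (incl_iobj x).
Proof. exact: sig_eq. Qed.

Lemma incl_imap_comp (x y z : subcat S) (g : hom y z) (f : hom x y) :
  incl_imap (comp g f) = comp (incl_imap g) (incl_imap f).
Proof. exact: sig_eq. Qed.

Definition inclusion : functor (subcat S) (subcat T) :=
  @Functor (subcat S) (subcat T) incl_iobj incl_imap
    incl_imap_id incl_imap_comp.
End Inclusion.

(** [S] and [T] are given as subcategories of a common ambient category; being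
    a subcategory of [T] is part of what [coreflective S T] asserts. *)
Definition coreflective (C : category) (S T : subcategory C) : Prop :=
  exists ST : subcat_le S T,
    full (inclusion ST) /\ has_right_adjoint (inclusion ST).

(** A subset of [T] together with a partial order on it. When [T] is a
    topological space, this is the ordered space whose topology is the
    subspace topology. *)
Record poset_in (T : Type) := PosetIn {
  carrier : set T;
  ple : T -> T -> Prop;
  ple_carrier : forall x y, ple x y -> carrier x /\ carrier y;
  ple_refl : forall x, carrier x -> ple x x;
  ple_anti : forall x y, ple x y -> ple y x -> x = y;
  ple_trans : forall x y z, ple x y -> ple y z -> ple x z }.

Definition subposet (T : Type) (P Q : poset_in T) : Prop :=
  carrier P `<=` carrier Q /\
  forall x y, carrier P x -> carrier P y -> (ple P x y <-> ple Q x y).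

Section Induced.
Variables (T : Type) (P : poset_in T) (A : set T).

Definition induced_dom := carrier P `&` A.
Definition induced_le x y := [/\ A x, A y & ple P x y].

Lemma induced_le_dom x y : induced_le x y -> induced_dom x /\ induced_dom y.
Proof. by case=> Ax Ay xy; have [] := ple_carrier xy. Qed.

Lemma induced_le_refl x : induced_dom x -> induced_le x x.
Proof. by move=> [Px Ax]; split=> //; apply: ple_refl. Qed.

Lemma induced_le_anti x y : induced_le x y ->
  induced_le y x -> x = y.
Proof. by move=> [_ _ xy] [_ _ yx]; apply: ple_anti xy yx. Qed.

Lemma induced_le_trans x y z : induced_le x y ->
  induced_le y z -> induced_le x z.
Proof. by move=> [Ax _ xy] [_ Az yz]; split=> //; apply: ple_trans xy yz. Qed.

Definition induced : poset_in T :=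
  @PosetIn T induced_dom induced_le induced_le_dom
    induced_le_refl induced_le_anti induced_le_trans.
End Induced.

Definition monotone_on (X Y : Type) (P : poset_in X) (Q : poset_in Y)
    (f : X -> Y) : Prop :=
  f @` carrier P `<=` carrier Q /\
  forall x y, ple P x y -> ple Q (f x) (f y).

(** The restriction of the total function [f] to [P] is a continuous order
    preserving map to [Q]; the values of [f] outside of [P] are irrelevant. *)
Definition order_map (X Y : topologicalType) (P : poset_in X)
    (Q : poset_in Y) (f : X -> Y) : Prop :=
  {within carrier P, continuous f} /\ monotone_on P Q f.

(** As maps between ordered subspaces are represented by total functions, this
    is only meaningful for nonempty [P] and [Q] (or [P] and [Q] in the same
    type). *)
Definition dihomeomorphic (X Y : topologicalType) (P : poset_in X)
    (Q : poset_in Y) : Prop :=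
  exists (f : X -> Y) (g : Y -> X),
    [/\ order_map P Q f, order_map Q P g,
        (forall x, carrier P x -> g (f x) = x) &
        (forall y, carrier Q y -> f (g y) = y)].

Section ProductOrder.
Variables (R : realType) (n : nat).
Local Open Scope ring_scope.

Definition product_le (x y : 'rV[R]_n) : Prop := forall i, x ord0 i <= y ord0 i.

Lemma product_le_dom x y : product_le x y ->
  [set: 'rV[R]_n] x /\ [set: 'rV[R]_n] y.
Proof. by []. Qed.

Lemma product_le_refl x : [set: 'rV[R]_n] x -> product_le x x.
Proof. by move=> _ i. Qed.

Lemma product_le_anti x y : product_le x y -> product_le y x -> x = y.
Proof.
by move=> xy yx; apply/rowP => i; apply/Order.POrderTheory.le_anti; rewrite xy yx.
Qed.

Lemma product_le_trans x y z : product_le x y ->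
  product_le y z -> product_le x z.
Proof. by move=> xy yz i; apply: Order.POrderTheory.le_trans (xy i) (yz i). Qed.

(** R^n with the product order; the topology of ['rV[R]_n] is the product
    topology. *)
Definition euclidean_space : poset_in 'rV[R]_n :=
  @PosetIn 'rV[R]_n setT product_le product_le_dom
    product_le_refl product_le_anti product_le_trans.
End ProductOrder.

Record local_order := LocalOrder {
  lo_space :> topologicalType;
  lo_base : set (poset_in lo_space);
  lo_basis : basis (@carrier lo_space @` lo_base);
  lo_compat : forall B B' x, lo_base B -> lo_base B' ->
    carrier B x -> carrier B' x ->
    exists B'', [/\ lo_base B'', carrier B'' x,
      subposet B'' B & subposet B'' B'] }.

(** Open subsets of elements of the base, with the induced order, are regarded
    as ordered open sets. *)
Definition ordered_open (X : local_order) (U : poset_in X) : Prop :=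
  open (carrier U) /\ exists2 B, lo_base B & subposet U B.

Definition ordered_nbhd (X : local_order) (x : X) (U : poset_in X) : Prop :=
  ordered_open U /\ carrier U x.

Definition lo_morphism (X Y : local_order) (f : X -> Y) : Prop :=
  continuous f /\
  forall (x : X) (V : poset_in Y), ordered_nbhd (f x) V ->
    exists U : poset_in X, ordered_nbhd x U /\ monotone_on U V f.

Definition local_embedding (X Y : local_order) (f : X -> Y) : Prop :=
  continuous f /\
  forall (x : X) (V : poset_in Y), ordered_nbhd (f x) V ->
    exists U : poset_in X, [/\ ordered_nbhd x U, monotone_on U V f &
      exists g : Y -> X,
        order_map (induced V (f @` carrier U)) U g /\
        forall u, carrier U u -> g (f u) = u].

Definition euclidean (R : realType) (n : nat) (X : local_order) : Prop :=
  forall x : X, exists U : poset_in X,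
    ordered_nbhd x U /\ dihomeomorphic U (euclidean_space R n).

Definition weakly_euclidean (R : realType) (n : nat) (X Y : local_order)
    (f : X -> Y) : Prop :=
  lo_morphism f /\
  forall (E : local_order) (g : E -> X),
    euclidean R n E -> local_embedding g -> local_embedding (f \o g).

Lemma monotone_on_comp (X Y Z : Type) (P : poset_in X) (Q : poset_in Y)
    (S : poset_in Z) (g : Y -> Z) (f : X -> Y) :
  monotone_on Q S g -> monotone_on P Q f -> monotone_on P S (g \o f).
Proof.
move=> [gQ gle] [fP fle]; split; last by move=> x y /fle /gle.
by move=> _ [x Px <-]; apply: gQ; exists (f x) => //; apply: fP; exists x.
Qed.

Lemma within_continuous_comp (X Y Z : topologicalType) (A : set X) (B : set Y)
    (f : X -> Y) (g : Y -> Z) :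
  {within A, continuous f} -> {within B, continuous g} -> f @` A `<=` B ->
  {within A, continuous (g \o f)}.
Proof.
move=> /subspace_continuousP fc /subspace_continuousP gc fAB.
apply/subspace_continuousP => x Ax N /= gN.
have Bfx : B (f x) by apply: fAB; exists x.
have /= := fc x Ax _ (gc _ Bfx _ gN).
rewrite /nbhs /= /within /=; apply: filterS => y NB Ay.
by apply: NB => //; apply: fAB; exists y.
Qed.

Lemma lo_morphism_id (X : local_order) : lo_morphism (@idfun X).
Proof.
split=> [x|x V Vx]; first exact: cvg_id.
by exists V; split=> //; split=> // _ [y Vy <-].
Qed.

Lemma lo_morphism_comp (X Y Z : local_order) (g : Y -> Z) (f : X -> Y) :
  lo_morphism g -> lo_morphism f -> lo_morphism (g \o f).
Proof.
move=> [gc gm] [fc fm]; split=> [x|x W Wx].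
  by apply: continuous_comp; [exact: fc|exact: gc].
have [V [Vx gVW]] := gm _ _ Wx; have [U [Ux fUV]] := fm _ _ Vx.
by exists U; split=> //; apply: monotone_on_comp gVW fUV.
Qed.

Lemma local_embedding_id (X : local_order) : local_embedding (@idfun X).
Proof.
split=> [x|x V Vx]; first exact: cvg_id.
exists V; split=> [//||]; first by split=> // _ [y Vy <-].
exists idfun; split=> //; split.
  by apply: continuous_subspaceT => y; exact: cvg_id.
by split=> [_ [y [Vy _] <-]//|y z []].
Qed.

Lemma local_embedding_comp (X Y Z : local_order) (g : Y -> Z) (f : X -> Y) :
  local_embedding g -> local_embedding f -> local_embedding (g \o f).
Proof.
move=> [gc gm] [fc fm]; split=> [x|x W Wx].
  by apply: continuous_comp; [exact: fc|exact: gc].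
have [V [Vx gVW [g' [[g'c [_ g'le]] g'K]]]] := gm _ _ Wx.
have [U [Ux fUV [f' [[f'c [_ f'le]] f'K]]]] := fm _ _ Vx.
have VfU u : carrier U u -> carrier V (f u).
  by move=> Uu; apply: fUV.1; exists u.
have WgV v : carrier V v -> carrier W (g v).
  by move=> Vv; apply: gVW.1; exists v.
exists U; split=> //; first exact: monotone_on_comp gVW fUV.
exists (f' \o g'); split; last by move=> u Uu /=; rewrite g'K ?f'K//; exact: VfU.
split; last first.
  split=> [_ [_ [_ [u Uu <-]] <-]|_ _ [[u Uu <-] [v Uv <-] uv]] /=.
    by rewrite g'K ?f'K//; exact: VfU.
  have Vu := VfU _ Uu; have Vv := VfU _ Uv.
  have fuv : ple V (f u) (f v).
    rewrite -[f u](g'K _ Vu) -[f v](g'K _ Vv).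
    by apply: g'le; split.
  by apply: f'le; rewrite (g'K _ Vu) (g'K _ Vv); split.
apply: (within_continuous_comp _ f'c).
- by apply: continuous_subspaceW g'c => z [Wz [u Uu zE]]; split=> //;
    exists (f u) => //; exact: VfU.
- move=> _ [z [_ [u Uu zE]] <-]; rewrite -zE /= g'K; last exact: VfU.
  by split; [exact: VfU|exists u].
Qed.

Lemma weakly_euclidean_id (R : realType) (n : nat) (X : local_order) :
  weakly_euclidean R n (@idfun X).
Proof. by split; first exact: lo_morphism_id. Qed.

Lemma weakly_euclidean_comp (R : realType) (n : nat) (X Y Z : local_order)
    (g : Y -> Z) (f : X -> Y) :
  weakly_euclidean R n g -> weakly_euclidean R n f ->
  weakly_euclidean R n (g \o f).
Proof.
move=> [gm gw] [fm fw]; split; first exact: lo_morphism_comp.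
by move=> E h Ee he; apply: (gw E (f \o h)) => //; exact: fw.
Qed.

Section LocalOrderCategory.
Definition LO_mor (X Y : local_order) := {f : X -> Y | lo_morphism f}.
Definition LO_mor_id X : LO_mor X X := exist _ idfun (lo_morphism_id X).
Definition LO_mor_comp X Y Z (g : LO_mor Y Z) (f : LO_mor X Y) : LO_mor X Z :=
  exist _ (sval g \o sval f) (lo_morphism_comp (svalP g) (svalP f)).

Lemma LO_mor_idl X Y (f : LO_mor X Y) : LO_mor_comp (LO_mor_id Y) f = f.
Proof. exact: sig_eq. Qed.

Lemma LO_mor_idr X Y (f : LO_mor X Y) : LO_mor_comp f (LO_mor_id X) = f.
Proof. exact: sig_eq. Qed.

Lemma LO_mor_assoc X Y Z T (h : LO_mor Z T)
    (g : LO_mor Y Z) (f : LO_mor X Y) :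
  LO_mor_comp h (LO_mor_comp g f) = LO_mor_comp (LO_mor_comp h g) f.
Proof. exact: sig_eq. Qed.

Definition LO : category :=
  @Category local_order LO_mor LO_mor_id LO_mor_comp
    LO_mor_idl LO_mor_idr LO_mor_assoc.
End LocalOrderCategory.

Definition LOe : subcategory LO :=
  @Subcategory LO (fun=> True) (fun X Y f => local_embedding (sval f))
    (fun X _ => local_embedding_id X)
    (fun X Y Z g f _ _ _ ge fe => local_embedding_comp ge fe).

Definition LOwe (R : realType) (n : nat) : subcategory LO :=
  @Subcategory LO (fun=> True) (fun X Y f => weakly_euclidean R n (sval f))
    (fun X _ => weakly_euclidean_id R n X)
    (fun X Y Z g f _ _ _ gw fw => weakly_euclidean_comp gw fw).

Definition Eucl (R : realType) (n : nat) : subcategory LO :=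
  @Subcategory LO (fun X => euclidean R n X)
    (fun X Y f => local_embedding (sval f))
    (fun X _ => local_embedding_id X)
    (fun X Y Z g f _ _ _ ge fe => local_embedding_comp ge fe).

(* Main.v *)
From HB Require Import structures.
From mathcomp Require Import all_boot all_order all_algebra.
From mathcomp Require Import all_classical all_reals all_analysis.
From mathcomp Require Import ring lra.
Require Import Defs.
Import Order.TTheory GRing.Theory Num.Theory.
Import numFieldNormedType.Exports.

(** The coreflection of a local order [X] is an etale space over [X]. Call a
    slice of [X] a subset of an ordered open set which, with the induced order
    and topology, is dihomeomorphic to R^n. A point of [etale R n X] is a point
    [x] of [X] together with the germ at [x] of a slice through [x]; every slice
    [S] lifts to the set of its own germs, and the lifts form an ordered base.
    The projection [pt] is a dihomeomorphism from each lift onto the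
    corresponding slice, so the etale space is euclidean and [pt] is a local
    embedding.

    Let [g : E -> X] be a local embedding with [E] euclidean. Small euclidean
    neighborhoods [U] of [e] are embedded by [g] onto slices, and the germ of
    the image at [g e] does not depend on [U] ([chart_agree]), so mapping [e] to
    that germ is a local embedding which lifts [g] ([lift_local_embedding]).

    The lift is unique because of a dimension argument. If [h] is another lift,
    [h e] is the germ of a slice [T], and [g] embeds a small [U] into [T]; the
    germs of [T] and of the image of [U] can only be compared if that image is
    open in [T]. This is invariance of domain, of which only the case of order
    embeddings of R^n is needed, and that case is elementary
    ([order_embedding_open]): the standard example of a poset of dimension [n],
    placed in a box, forces an order embedding to act on each coordinate
    separately, up to a permutation of the coordinates, and the intermediate
    value theorem concludes.

    So [pt] is a universal arrow from euclidean local orders to [X]. As a local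
    embedding it belongs to both target categories, and in both of them the maps
    whose domain is euclidean are the local embeddings: a weakly euclidean map
    may be tested on the identity of its domain. *)

Set Implicit Arguments.
Unset Strict Implicit.
Unset Printing Implicit Defensive.

Local Open Scope classical_set_scope.

(** * Order embeddings of R^n are open *)

Section OrderEmbedding.
Variables (R : realType) (n : nat).
Local Open Scope ring_scope.

Lemma continuous_row (T : topologicalType) (f : T -> 'rV[R]_n) (x : T) :
  (forall i, f y ord0 i @[y --> x] --> f x ord0 i) -> f @ x --> f x.
Proof.
move=> fc A [P Px PA].
have : \forall y \near x, forall i, P ord0 i (f y ord0 i).
  apply: (@filter_forall _ _ (fun i y => P ord0 i (f y ord0 i))) => i.
  by apply: fc; exact: Px.
by apply: filterS => y Py; apply: PA => i j; rewrite ord1.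
Qed.

Definition set_coord (u : 'rV[R]_n) (i : 'I_n) (t : R) : 'rV[R]_n :=
  \row_j (if j == i then t else u ord0 j).

Lemma set_coord_continuous u i : continuous (set_coord u i).
Proof.
move=> t; apply: continuous_row => j.
under eq_fun do rewrite mxE; rewrite mxE.
by case: eqP => _; [exact: cvg_id|exact: cvg_cst].
Qed.

Lemma not_product_le (x y : 'rV[R]_n) :
  ~ product_le x y -> exists i, y ord0 i < x ord0 i.
Proof. by move=> /existsNP[i /negP]; rewrite -ltNge => ?; exists i. Qed.

Definition order_embedding (F : 'rV[R]_n -> 'rV[R]_n) :=
  forall x y, product_le (F x) (F y) <-> product_le x y.

(** The points [up k] and [down k] form the standard example of a poset of
    dimension [n]: [up j] is below [down k] exactly when [j] and [k] differ.
    After [F], each incomparability is witnessed by a coordinate [s k]; no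
    coordinate can witness two of them, so [s] is a permutation. A pair [y], [z]
    with [z i < y i] yields another standard example when the [i]th points are
    moved inwards, and its [i]th witness can only be [s i]. *)
Lemma order_embedding_coord F (lo hi : 'rV[R]_n) :
  order_embedding F -> (forall i, lo ord0 i < hi ord0 i) ->
  exists2 s : 'I_n -> 'I_n, injective s &
    forall y z i, product_le lo y -> product_le y hi ->
      product_le lo z -> product_le z hi ->
      z ord0 i < y ord0 i -> F z ord0 (s i) < F y ord0 (s i).
Proof.
move=> FE lohi.
pose up i t := set_coord lo i t; pose down i t := set_coord hi i t.
have upE i t j : up i t ord0 j = if j == i then t else lo ord0 j by rewrite mxE.
have downE i t j : down i t ord0 j = if j == i then t else hi ord0 j.
  by rewrite mxE.
have [s sP] : {s : 'I_n -> 'I_n & forall i,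
    F (down i (lo ord0 i)) ord0 (s i) < F (up i (hi ord0 i)) ord0 (s i)}.
  apply: (@choice _ _ (fun i j => F (down i (lo ord0 i)) ord0 j <
    F (up i (hi ord0 i)) ord0 j)) => i.
  apply: not_product_le => /FE /(_ i).
  by rewrite upE downE eqxx leNgt lohi.
have up_down i j t t' : i != j -> t <= hi ord0 i -> lo ord0 j <= t' ->
    product_le (up i t) (down j t').
  move=> ij ti tj k; rewrite upE downE.
  case: (eqVneq k i) => [->|_]; first by rewrite (negbTE ij).
  by case: (eqVneq k j) => [->//|_]; exact: ltW.
have s_inj : injective s.
  move=> i j sij; apply/eqP/negP => /negP ij.
  have /FE/(_ (s i)) h1 := up_down _ _ _ _ ij (lexx _) (lexx _).
  rewrite eq_sym in ij.
  have /FE/(_ (s i)) h2 := up_down _ _ _ _ ij (lexx _) (lexx _).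
  have := sP j; rewrite -sij => h3; have h4 := sP i; clear sij.
  by lra.
exists s => // y z i loy yhi loz zhi zy.
(* The [i]th pair of the standard example, moved inwards to [y] and [z]. *)
have [k Fk] : exists k,
    F (down i (z ord0 i)) ord0 k < F (up i (y ord0 i)) ord0 k.
  apply: not_product_le => /FE /(_ i).
  by rewrite upE downE eqxx leNgt zy.
have [t _ tK] := injF_bij s_inj.
suff ks : k = s i.
  rewrite -ks.
  have /FE/(_ k) h1 : product_le z (down i (z ord0 i)).
    by move=> j; rewrite downE; case: eqVneq => [->//|_].
  have /FE/(_ k) h2 : product_le (up i (y ord0 i)) y.
    by move=> j; rewrite upE; case: eqVneq => [->//|_].
  by lra.
rewrite -[k]tK; congr s; apply/eqP/negP => /negP ti.
have /FE/(_ k) h1 := up_down _ _ _ _ ti (lexx _) (loz i).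
rewrite eq_sym in ti.
have /FE/(_ k) h2 := up_down _ _ _ _ ti (yhi i) (lexx _).
have := sP (t k); rewrite tK => h3.
by lra.
Qed.

(** The strict monotonicity of the coordinate [s i] in the [i]th coordinate
    extends by continuity to equality, so that this coordinate of [F y] is a
    function [phi i] of [y i] alone: the image of a box contains the box with
    sides the images of the [phi i]. *)
Lemma order_embedding_open F :
  continuous F -> order_embedding F -> open (range F).
Proof.
move=> Fc FE; rewrite openE => _ [x _ <-].
pose lo := \row_i (x ord0 i - 2); pose hi := \row_i (x ord0 i + 2).
have [|s s_inj sP] := @order_embedding_coord F lo hi FE.
  by move=> i; rewrite !mxE; lra.
pose mid (y : 'rV[R]_n) := forall i, x ord0 i - 1 <= y ord0 i <= x ord0 i + 1.
have sP' y z i : mid y -> mid z -> z ord0 i < y ord0 i ->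
    F z ord0 (s i) < F y ord0 (s i).
  by move=> ym zm; apply: sP => j; rewrite mxE; have := ym j; have := zm j; lra.
have coordc i : continuous (fun y : 'rV[R]_n => (F y) ord0 i).
  by move=> y; exact: (@continuous_comp _ _ _ F (fun u : 'rV[R]_n => u ord0 i) y
    (Fc y)    (@coord_continuous _ _ _ _ _ _)).
(* Otherwise increasing the [i]th coordinate of [y] slightly would contradict
   strict monotonicity; the larger box leaves room for this increase. *)
have s_le y z i : mid y -> mid z -> y ord0 i = z ord0 i ->
    F z ord0 (s i) <= F y ord0 (s i).
  move=> ym zm yz; rewrite leNgt; apply/negP => Fyz.
  have : \forall t \near y ord0 i,
      F (set_coord y i t) ord0 (s i) < F z ord0 (s i).
    have yE : set_coord y i (y ord0 i) = y.
      by apply/rowP => j; rewrite mxE; case: eqVneq => [->|].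
    have := @continuous_comp _ _ _ (set_coord y i) (fun u => F u ord0 (s i))
      (y ord0 i) (@set_coord_continuous y i _) (coordc _ _).
    by move=> /cvgr_lt; apply; rewrite /= yE.
  move=> /nbhs_ballP[e /= e0 eP].
  pose d := Num.min (e / 2) 1.
  have d0 : 0 < d by rewrite lt_min ltr01 divr_gt0.
  have dle : d <= 1 by rewrite ge_min lexx orbT.
  have de : d <= e / 2 by rewrite ge_min lexx.
  have /eP : ball (y ord0 i) e (y ord0 i + d).
    by rewrite /ball /= opprD addNKr normrN gtr0_norm//; lra.
  apply/negP; rewrite -leNgt; apply/ltW.
  apply: sP; rewrite ?mxE ?eqxx.
  - by move=> j; rewrite !mxE; have := ym i; have := ym j;
      case: eqVneq => [->|_]; lra.
  - by move=> j; rewrite !mxE; have := ym i; have := ym j;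
      case: eqVneq => [->|_]; lra.
  - by move=> j; rewrite !mxE; have := zm j; lra.
  - by move=> j; rewrite !mxE; have := zm j; lra.
  - by rewrite -yz; lra.
have s_eq y z i : mid y -> mid z -> y ord0 i = z ord0 i ->
    F y ord0 (s i) = F z ord0 (s i).
  by move=> ym zm yz; apply/eqP; rewrite eq_le !s_le.
pose phi i t := F (set_coord x i t) ord0 (s i).
have mid_set i t : x ord0 i - 1 <= t <= x ord0 i + 1 -> mid (set_coord x i t).
  by move=> ? j; rewrite mxE; case: eqVneq => [->//|_]; lra.
have midx : mid x by move=> i; lra.
have [r _ rK] := injF_bij s_inj.
exists (fun _ k => [set t |
    phi (r k) (x ord0 (r k) - 1) < t < phi (r k) (x ord0 (r k) + 1)]).
  move=> i0 k; rewrite ord1 {i0}.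
  under eq_set do rewrite -[_ < _ < _]/(_ \in `]_, _[).
  apply: near_in_itvoo.
  rewrite in_itv /= /phi rK.
  have := @sP' x (set_coord x (r k) (x ord0 (r k) - 1)) (r k) midx.
  have := @sP' (set_coord x (r k) (x ord0 (r k) + 1)) x (r k) ^~ midx.
  rewrite !mxE eqxx rK => h1 h2; rewrite h1 ?h2//; try lra.
  - by apply: mid_set; lra.
  - by apply: mid_set; lra.
move=> w wP.
have ivt i : exists t,
    x ord0 i - 1 <= t <= x ord0 i + 1 /\ phi i t = w ord0 (s i).
  have := wP ord0 (s i).
  have -> : r (s i) = i by apply: s_inj; rewrite rK.
  move=> /= /andP[lw wh].
  have [] := @IVT R (phi i) (x ord0 i - 1) (x ord0 i + 1) (w ord0 (s i)).
  - by lra.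
  - apply: continuous_subspaceT => t; 
    exact: (continuous_comp (@set_coord_continuous x i _) (coordc _ _)).
  - by rewrite ge_min le_max (ltW lw) (ltW wh) orbT.
  by move=> c; rewrite in_itv /= => ? ?; exists c.
have [t tP] := choice ivt.
exists (\row_i t i) => //; apply/rowP => k.
rewrite -[k]rK -(tP (r k)).2; apply: s_eq.
- by move=> i; rewrite mxE; exact: (tP i).1.
- exact: mid_set (tP _).1.
- by rewrite !mxE eqxx.
Qed.
End OrderEmbedding.


(** * Arbitrarily small copies of R^n *)

Section OrderMaps.
Variables X Y Z : topologicalType.

Lemma within_continuous_open (A : set X) (f : X -> Y) (B : set Y) :
  {within A, continuous f} -> open B ->
  exists2 O, open O & forall x, A x -> (O x <-> B (f x)).
Proof.
move=> /continuousP fc /fc /open_subspaceP[G oG GE]; exists G => // x Ax.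
have : (G `&` A) x <-> ((f @^-1` B) `&` A) x by rewrite GE.
by rewrite /setI /=; tauto.
Qed.

Lemma order_map_comp (P : poset_in X) (Q : poset_in Y) (S : poset_in Z)
    (g : Y -> Z) (f : X -> Y) :
  order_map Q S g -> order_map P Q f -> order_map P S (g \o f).
Proof.
move=> [gc gm] [fc fm]; split; last exact: monotone_on_comp gm fm.
exact: within_continuous_comp fc gc fm.1.
Qed.

Lemma order_map_induced (P : poset_in X) (Q : poset_in Y) (f : X -> Y)
    (A : set X) (B : set Y) :
  order_map P Q f -> (forall x, carrier P x -> A x -> B (f x)) ->
  order_map (induced P A) (induced Q B) f.
Proof.
move=> [fc [fPQ fle]] AB; split.
  by apply: continuous_subspaceW fc => x [].
split=> [_ [x [Px Ax] <-]|x y [Ax Ay xy]].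
  by split; [apply: fPQ; exists x|exact: AB].
by have [Px Py] := ple_carrier xy; split; [exact: AB|exact: AB|exact: fle].
Qed.

End OrderMaps.

Lemma dihomeomorphic_trans (X Y Z : topologicalType)
    (P : poset_in X) (Q : poset_in Y) (S : poset_in Z) :
  dihomeomorphic P Q -> dihomeomorphic Q S -> dihomeomorphic P S.
Proof.
move=> [f [f' [fm f'm fK f'K]]] [g [g' [gm g'm gK g'K]]].
exists (g \o f), (f' \o g'); split.
- exact: order_map_comp gm fm.
- exact: order_map_comp f'm g'm.
- by move=> x Px /=; rewrite gK ?fK//; apply: fm.2.1; exists x.
- by move=> z Sz /=; rewrite f'K ?g'K//; apply: g'm.2.1; exists z.
Qed.

Section Boxes.
Variable R : realType.
Local Open Scope ring_scope.

(** An increasing homeomorphism from the real line to ]-1, 1[, with inverse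
    [stretch]; applied coordinatewise it identifies R^n and a cube. *)
Definition squash (t : R) := t / (1 + `|t|).
Definition stretch (s : R) := s / (1 - `|s|).

Let squash_den (t : R) : 0 < 1 + `|t|.
Proof. by rewrite ltr_pwDl. Qed.

Lemma norm_squash t : `|squash t| = `|t| / (1 + `|t|).
Proof. by rewrite normrM normfV (gtr0_norm (squash_den t)). Qed.

Lemma squash_lt1 t : `|squash t| < 1.
Proof. by rewrite norm_squash ltr_pdivrMr// mul1r ltrDr. Qed.

Lemma squashK : cancel squash stretch.
Proof.
move=> t; rewrite /stretch norm_squash /squash.
have d := squash_den t; field; by rewrite addrK oner_neq0 gt_eqF.
Qed.

Lemma stretchK s : `|s| < 1 -> squash (stretch s) = s.
Proof.
move=> s1; have d : 0 < 1 - `|s| by rewrite subr_gt0.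
rewrite /squash /stretch normrM normfV (gtr0_norm d).
field; by rewrite subrK oner_neq0 gt_eqF.
Qed.

Lemma squash_homo t t' : t <= t' -> squash t <= squash t'.
Proof.
move=> tt'; rewrite ler_pdivrMr// mulrAC ler_pdivlMr//.
have [t0|t0] := ger0P t; have [t'0|t'0] := ger0P t'; nra.
Qed.

Lemma stretch_homo s s' : `|s| < 1 -> `|s'| < 1 -> s <= s' ->
  stretch s <= stretch s'.
Proof.
move=> s1 s'1 ss'; rewrite ler_pdivrMr ?subr_gt0// mulrAC.
rewrite ler_pdivlMr ?subr_gt0//.
by move: s1 s'1; have [t0|t0] := ger0P s; have [t'0|t'0] := ger0P s'; nra.
Qed.

Lemma squash_continuous : continuous squash.
Proof.
move=> t; apply: cvgM; first exact: cvg_id.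
apply: cvgV; first by rewrite gt_eqF.
by apply: cvgD; [exact: cvg_cst|exact: norm_continuous].
Qed.

Lemma stretch_continuous s : `|s| < 1 -> {for s, continuous stretch}.
Proof.
move=> s1; apply: cvgM; first exact: cvg_id.
apply: cvgV; first by rewrite gt_eqF// subr_gt0.
by apply: cvgB; [exact: cvg_cst|exact: norm_continuous].
Qed.

Variable n : nat.

Lemma continuous_coord_comp (h : R -> R) (u : 'rV[R]_n) i :
  {for u ord0 i, continuous h} ->
  h (w ord0 i) @[w --> u] --> h (u ord0 i).
Proof.
apply: (@continuous_comp _ _ _ (fun w : 'rV[R]_n => w ord0 i) h).
exact: coord_continuous.
Qed.

Lemma dihomeomorphic_ball (v : 'rV[R]_n) (e : R) : 0 < e ->
  dihomeomorphic (induced (euclidean_space R n) (ball v e))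
    (euclidean_space R n).
Proof.
move=> e0.
pose c (u : 'rV[R]_n) i : R := (u ord0 i - v ord0 i) / e.
have ballE (u : 'rV[R]_n) : ball v e u <-> forall i, `|c u i| < 1.
  have cE i : (`|c u i| < 1) = (`|v ord0 i - u ord0 i| < e).
    by rewrite normrM normfV (gtr0_norm e0) ltr_pdivrMr// mul1r distrC.
  split=> [[_ h] i|h]; first by rewrite cE; exact: h.
  by split=> // i j; rewrite ord1 /ball /= -cE.
exists (fun u => \row_i stretch (c u i)),
  (fun w : 'rV[R]_n => \row_i (v ord0 i + e * squash (w ord0 i))).
have cK w i :
    c (\row_i (v ord0 i + e * squash (w ord0 i))) i = squash (w ord0 i).
  by rewrite /c mxE; field; rewrite gt_eqF.
split.
- split.
    apply: continuous_in_subspaceT => u /set_mem[_ /ballE bu].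
    apply: continuous_row => i; under eq_fun do rewrite mxE; rewrite mxE.
    apply: (@continuous_coord_comp (fun t => stretch ((t - v ord0 i) / e))).
    apply: (@continuous_comp _ _ _ (fun t => (t - v ord0 i) / e) stretch).
      by apply: cvgM; [apply: cvgB; [exact: cvg_id|]|]; exact: cvg_cst.
    exact: stretch_continuous (bu i).
  split=> [//|x y [/ballE bx /ballE b_y xy] i].
  rewrite !mxE; apply: stretch_homo => //.
  by rewrite ler_wpM2r ?invr_ge0 ?(ltW e0)// lerB.
- split.
    apply: continuous_subspaceT => w.
    apply: continuous_row => i; under eq_fun do rewrite mxE; rewrite mxE.
    apply: (@continuous_coord_comp (fun t => v ord0 i + e * squash t)).
    apply: cvgD; first exact: cvg_cst.
    by apply: cvgM; [exact: cvg_cst|exact: squash_continuous].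
  have bw w : ball v e (\row_i (v ord0 i + e * squash (w ord0 i))).
    by apply/ballE => i; rewrite cK; exact: squash_lt1.
  split=> [_ [w _ <-]|x y xy]; split=> // i.
  by rewrite !mxE lerD2l ler_pM2l//; apply/squash_homo/xy.
- move=> u [_ /ballE bu]; apply/rowP => i; rewrite !mxE stretchK//.
  by rewrite /c; field; rewrite gt_eqF.
- by move=> w _; apply/rowP => i; rewrite mxE cK squashK.
Qed.

(** These balls are open because they are cubes; in a general pseudometric
    space a ball need not be open. *)
Lemma row_ball_open (v : 'rV[R]_n) (e : R) : 0 < e -> open (ball v e).
Proof.
move=> e0; rewrite openE => u [_ vu].
exists (fun i j => ball (v i j) e) => [i j|w vw]; last by split.
by apply: open_nbhs_nbhs; split; [exact: ball_open|exact: vu].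
Qed.

(** This reconciles the global condition of being dihomeomorphic to all of R^n
    with local arguments: euclidean neighborhoods can be shrunk, as the preimage
    of a cube is again a copy of R^n. *)
Lemma dihomeomorphic_shrink (X : topologicalType) (P : poset_in X) (x : X)
    (W : set X) :
  dihomeomorphic P (euclidean_space R n) -> carrier P x -> nbhs x W ->
  exists O, [/\ open O, O x, O `<=` W &
    dihomeomorphic (induced P O) (euclidean_space R n)].
Proof.
move=> [f [g [fm gm fK gK]]] Px xW.
have gc : continuous g.
  move=> v; have := gm.1 v.
  by rewrite /continuous_at (nbhs_subspaceT v).
have /gc/nbhs_ballP[e /= e0 eW] : nbhs (g (f x)) W°.
  by rewrite fK//; exact: nbhs_interior.
have [G oG GE] := within_continuous_open fm.1 (@row_ball_open (f x) e e0).
exists (G `&` W°); split.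
- by apply: openI => //; exact: open_interior.
- by split; [apply/GE => //; exact: ballxx|].
- by move=> y [_ /interior_subset].
apply: dihomeomorphic_trans (dihomeomorphic_ball (f x) e0).
exists f, g; split.
- by apply: (order_map_induced fm) => y Py [Gy _]; exact: (GE y Py).1.
- apply: (order_map_induced gm) => v _ bv; split; last exact: eW.
  by apply/GE; [apply: gm.2.1; exists v|rewrite gK].
- by move=> y [/fK].
- by move=> v [/gK].
Qed.
End Boxes.


(** * Ordered neighborhoods and local embeddings *)

Section LocalOrder.
Variable X : local_order.

Lemma base_open (B : poset_in X) : lo_base B -> open (carrier B).
Proof. by move=> XB; apply: (lo_basis X).1; exists B. Qed.

Lemma ordered_open_base (B : poset_in X) : lo_base B -> ordered_open B.
Proof. by move=> XB; split; [exact: base_open|exists B => //; split]. Qed.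

Lemma ordered_open_induced (U : poset_in X) (A : set X) :
  ordered_open U -> open A -> ordered_open (induced U A).
Proof.
move=> [oU [B XB [UB leB]]] oA; split; first exact: openI.
exists B => //; split=> [x [/UB]//|x y [Ux Ax] [Uy Ay]].
by split=> [[_ _ /(leB _ _ Ux Uy)]|/(leB _ _ Ux Uy)].
Qed.

Lemma ordered_nbhd_exists (x : X) : exists U, ordered_nbhd x U.
Proof.
have [_ [[B XB <-] Bx] _] := (lo_basis X).2 x _ (@filterT _ (nbhs x) _).
by exists B; split=> //; exact: ordered_open_base.
Qed.

(** Compatibility in the ordered base gives each point a well defined germ of
    order. It is the reason why germs of slices below are germs of mere subsets
    of [X]. *)
Lemma ordered_nbhd_agree (x : X) (U V : poset_in X) :
  ordered_nbhd x U -> ordered_nbhd x V ->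
  exists W, [/\ open W, W x, W `<=` carrier U `&` carrier V &
    forall y z, W y -> W z -> (ple U y z <-> ple V y z)].
Proof.
move=> [[oU [B XB [UB leB]]] Ux] [[oV [B' XB' [VB' leB']]] Vx].
have [B'' [XB'' B''x [_ leB''] [_ leB''']]] :=
  lo_compat XB XB' (UB _ Ux) (VB' _ Vx).
exists (carrier U `&` carrier V `&` carrier B''); split=> [||y []//|].
- by apply: openI; [exact: openI|exact: base_open].
- by [].
- move=> y z [[Uy Vy] By] [[Uz Vz] Bz].
  have := leB _ _ Uy Uz; have := leB' _ _ Vy Vz.
  by have := leB'' _ _ By Bz; have := leB''' _ _ By Bz; tauto.
Qed.

End LocalOrder.

Section Embeds.
Variables X Y : local_order.

(** The condition imposed by [local_embedding] on a pair of ordered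
    neighborhoods. *)
Definition embeds (U : poset_in X) (V : poset_in Y) (f : X -> Y) : Prop :=
  monotone_on U V f /\
  exists g : Y -> X, order_map (induced V (f @` carrier U)) U g /\
    forall u, carrier U u -> g (f u) = u.

Lemma embeds_subposet (U U' : poset_in X) (V : poset_in Y) (f : X -> Y) :
  subposet U' U -> embeds U V f -> embeds U' V f.
Proof.
move=> [sU leU] [[fUV fle] [g [[gc [gU gle]] gK]]].
have VU x y : ple U' x y -> ple U x y.
  by move=> xy; have [? ?] := ple_carrier xy; exact/leU.
split.
  split=> [_ [x U'x <-]|x y /VU/fle//].
  by apply: fUV; exists x => //; exact: sU.
exists g; split; last by move=> u /sU/gK.
split.
  apply: continuous_subspaceW gc => y [Vy [u U'u uy]]; split=> //.
  by exists u => //; exact: sU.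
split=> [_ [_ [_ [u U'u <-]] <-]|_ _ [[u U'u <-] [v U'v <-] uv]].
  by rewrite gK//; exact: sU.
have Uu := sU _ U'u; have Uv := sU _ U'v.
rewrite !gK//; apply/leU => //; rewrite -(gK u)// -(gK v)//.
by apply: gle; split=> //; exact: imageP.
Qed.

(** It suffices to embed one neighborhood of [x] into one neighborhood of
    [f x], since any other neighborhood of [f x] carries the same order near
    [f x]. *)
Lemma local_embedding_of_embeds (f : X -> Y) :
  continuous f ->
  (forall x, exists U V,
    [/\ ordered_nbhd x U, ordered_nbhd (f x) V & embeds U V f]) ->
  local_embedding f.
Proof.
move=> fc fE; split=> // x V' V'x.
have [U [V [[oU Ux] Vx [[fUV fle] [g [[gc [gU gle]] gK]]]]]] := fE x.
have [W [oW Wx sW leW]] := ordered_nbhd_agree Vx V'x.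
exists (induced U (f @^-1` W)); split.
- split=> //; apply: ordered_open_induced => //.
  by apply: open_comp => // y _; exact: fc.
- split=> [_ [y [_ Wy] <-]|y z [Wy Wz /fle/leW]]; last exact.
  exact: (sW _ Wy).2.
- exists g; split; last by move=> u [/gK].
  split.
    apply: continuous_subspaceW gc => _ [_ [u [Uu Wu] <-]]; split.
      by apply: fUV; exists u.
    by exists u.
  split=> [_ [_ [_ [u [Uu Wu] <-]] <-]|_ _ [[u [Uu Wu] <-] [v [Uv Wv] <-] uv]].
    by rewrite gK.
  rewrite !gK//; split=> //; rewrite -(gK u)// -(gK v)//.
  by apply: gle; split; [exists u|exists v|exact/leW].
Qed.
End Embeds.

(** * The etale space of slices *)

Section Germs.
Variable X : topologicalType.
Implicit Types (x : X) (A B : set X).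

Definition germ x A : set (set X) := [set B | \forall y \near x, A y <-> B y].

Lemma germP x A B : germ x A = germ x B <-> \forall y \near x, A y <-> B y.
Proof.
split=> [E|AB].
  suff : germ x A B by [].
  by rewrite E; apply: nearW.
apply/seteqP; split=> C; apply: filterS2 AB => y; tauto.
Qed.

Lemma germI_open x A B : open B -> B x -> germ x (A `&` B) = germ x A.
Proof.
move=> oB Bx; apply/germP; apply: filterS (open_nbhs_nbhs (conj oB Bx)) => y By.
by split=> [[]|].
Qed.

Lemma germ_eq_on x A B O : open O -> O x ->
  (forall y, O y -> (A y <-> B y)) -> germ x A = germ x B.
Proof.
move=> oO Ox AB; apply/germP.
exact: filterS AB (open_nbhs_nbhs (conj oO Ox)).
Qed.
End Germs.

Section Slices.
Variables (R : realType) (n : nat) (X : local_order).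

Definition slice (S : poset_in X) : Prop :=
  (exists2 V, ordered_open V & subposet S V) /\
  dihomeomorphic S (euclidean_space R n).

Lemma slice_shrink S x W : slice S -> carrier S x -> nbhs x W ->
  exists G, [/\ open G, G x, G `<=` W & slice (induced S G)].
Proof.
move=> [[V oV [SV leV]] SR] Sx xW.
have [G [oG Gx GW GR]] := dihomeomorphic_shrink SR Sx xW.
exists G; split=> //; split=> //; exists V => //.
split=> [y [/SV]//|y z [Sy Gy] [Sz Gz]].
by split=> [[_ _ /(leV _ _ Sy Sz)]|/(leV _ _ Sy Sz)].
Qed.

(** Slices with the same germ of carrier also have the same germ of order,
    because both orders come from the local order of [X]. *)
Lemma slice_agree S T x : slice S -> slice T -> carrier S x -> carrier T x ->
  germ x (carrier S) = germ x (carrier T) ->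
  exists W, [/\ open W, W x &
    forall y z, W y -> W z -> (ple S y z <-> ple T y z)].
Proof.
move=> [[U oU [SU leU]] _] [[V oV [TV leV]] _] Sx Tx /germP.
rewrite /prop_near1 nbhsE => -[N [oN Nx] NST].
have [W [oW Wx _ leW]] :=
  ordered_nbhd_agree (conj oU (SU _ Sx)) (conj oV (TV _ Tx)).
exists (W `&` N); split=> [|//|y z [Wy Ny] [Wz Nz]]; first exact: openI.
have [STy TSy] := NST _ Ny; have [STz TSz] := NST _ Nz.
by split=> yz; have [cy cz] := ple_carrier yz;
  [apply/leV; [exact: STy|exact: STz|]; apply/leW => //; apply/leU|
   apply/leU; [exact: TSy|exact: TSz|]; apply/leW => //; apply/leV].
Qed.

(** A germ is encoded as the set of all subsets of [X] that coincide with the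
    given one near [pt], so that equality of germs is equality of sets. *)
Record etale := Etale {
  pt : X;
  pt_germ : set (set X);
  etaleP : exists S,
    [/\ slice S, carrier S pt & pt_germ = germ pt (carrier S)] }.

HB.instance Definition _ := gen_eqMixin etale.
HB.instance Definition _ := gen_choiceMixin etale.

Lemma etale_eq p q : pt p = pt q -> pt_germ p = pt_germ q -> p = q.
Proof.
case: p q => [x G pP] [y H qP] /= xy GH; subst y H.
by congr Etale; exact: Prop_irrelevance.
Qed.

Definition lift_set (S : poset_in X) : set etale :=
  [set p | carrier S (pt p) /\ pt_germ p = germ (pt p) (carrier S)].

Lemma lift_set_exists p : exists2 S, slice S & lift_set S p.
Proof. by have [S [sS Sp Gp]] := etaleP p; exists S. Qed.

Lemma lift_set_induced S (G : set X) p : open G ->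
  lift_set (induced S G) p <-> lift_set S p /\ G (pt p).
Proof.
move=> oG; rewrite /lift_set /= /induced_dom.
by split=> [[[Sp Gp]]|[[Sp ->] Gp]]; rewrite germI_open.
Qed.

Lemma lift_set_shrink S p W : slice S -> lift_set S p -> nbhs (pt p) W ->
  exists T, [/\ slice T, lift_set T p & forall q, lift_set T q -> W (pt q)].
Proof.
move=> sS Sp pW; have [G [oG Gp GW sG]] := slice_shrink sS Sp.1 pW.
exists (induced S G); split=> //; first exact/lift_set_induced.
by move=> q /lift_set_induced[] // _ /GW.
Qed.

(** Two lifts through [p] share the lift of a smaller slice, and with the same
    order. This provides the intersections required of a topology and of an
    ordered base, and the continuity of sections. *)
Lemma lift_set_meet S T p : slice S -> slice T ->
  lift_set S p -> lift_set T p ->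
  exists G, [/\ open G, G (pt p), slice (induced S G),
    forall y z, G y -> G z -> (ple S y z <-> ple T y z) &
    forall q, G (pt q) -> lift_set S q -> lift_set T q].
Proof.
move=> sS sT [Sp Gp] [Tp]; rewrite Gp => GST.
have [W [oW Wp leW]] := slice_agree sS sT Sp Tp GST.
have [G [oG Gp' GW sG]] := slice_shrink sS Sp (open_nbhs_nbhs (conj oW Wp)).
exists G; split=> // [y z /GW Wy /GW Wz|q /GW Wq [Sq Gq]]; first exact: leW.
have ST y : W y -> (carrier S y <-> carrier T y).
  move=> Wy; have [ST TS] := leW _ _ Wy Wy; split=> yy.
    exact: (ple_carrier (ST (ple_refl yy))).1.
  exact: (ple_carrier (TS (ple_refl yy))).1.
split; first exact/ST.
by rewrite Gq; exact: germ_eq_on oW Wq ST.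
Qed.

Definition etale_open : set (set etale) := [set A | forall p, A p ->
  exists S, [/\ slice S, lift_set S p & lift_set S `<=` A]].

Let etale_openT : etale_open setT.
Proof. by move=> p _; have [S sS Sp] := lift_set_exists p; exists S. Qed.

Let etale_openI : setI_closed etale_open.
Proof.
move=> A B oA oB p [/oA[S [sS Sp SA]] /oB[T [sT Tp TB]]].
have [G [oG Gp sG _ GST]] := lift_set_meet sS sT Sp Tp.
exists (induced S G); split=> //; first exact/lift_set_induced.
move=> q /lift_set_induced[//|Sq Gq]; split; first exact: SA.
by apply: TB; exact: GST.
Qed.

Let etale_open_bigU (I : Type) (f : I -> set etale) :
  (forall i, etale_open (f i)) -> etale_open (\bigcup_i f i).
Proof.
move=> of_ p [i _ /of_[S [sS Sp Sf]]]; exists S; split=> // q /Sf fq.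
by exists i.
Qed.

HB.instance Definition _ := isOpenTopological.Build etale
  etale_openT etale_openI etale_open_bigU.

Lemma open_etaleE (A : set etale) : open A = etale_open A.
Proof. by []. Qed.

Lemma lift_set_open S : slice S -> open (lift_set S).
Proof. by move=> sS; rewrite open_etaleE => p Sp; exists S; split. Qed.

Lemma nbhs_lift S p : slice S -> lift_set S p -> nbhs p (lift_set S).
Proof. by move=> /lift_set_open oS Sp; apply: open_nbhs_nbhs; split. Qed.

Lemma nbhs_etaleP p (N : set etale) : nbhs p N ->
  exists S, [/\ slice S, lift_set S p & lift_set S `<=` N].
Proof.
rewrite nbhsE => -[A [oA Ap] AN].
by have [S [sS Sp SA]] := oA _ Ap; exists S; split=> // q /SA/AN.
Qed.

Section Lift.
Variable S : poset_in X.
Definition lift_le p q := [/\ lift_set S p, lift_set S q & ple S (pt p) (pt q)].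

Let lift_le_dom p q : lift_le p q -> lift_set S p /\ lift_set S q.
Proof. by case. Qed.

Let lift_le_refl p : lift_set S p -> lift_le p p.
Proof. by move=> Sp; split=> //; apply: ple_refl; exact: Sp.1. Qed.

Let lift_le_anti p q : lift_le p q -> lift_le q p -> p = q.
Proof.
move=> [[_ Gp] [_ Gq] pq] [_ _ qp].
have E : pt p = pt q by exact: ple_anti pq qp.
by apply: etale_eq => //; rewrite Gp Gq E.
Qed.

Let lift_le_trans p q r : lift_le p q -> lift_le q r -> lift_le p r.
Proof. by move=> [Sp _ pq] [_ Sr qr]; split=> //; exact: ple_trans pq qr. Qed.

Definition lift : poset_in etale :=
  PosetIn lift_le_dom lift_le_refl lift_le_anti lift_le_trans.
End Lift.

Let etale_basis : basis (@carrier etale @` (lift @` slice)).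
Proof.
split=> [_ [_ [S sS <-] <-]|p N /nbhs_etaleP[S [sS Sp SN]]].
  exact: lift_set_open.
by exists (lift_set S) => //; split=> //; exists (lift S) => //; exists S.
Qed.

Let etale_compat (B B' : poset_in etale) p : (lift @` slice) B ->
  (lift @` slice) B' -> carrier B p -> carrier B' p ->
  exists B'', [/\ (lift @` slice) B'', carrier B'' p,
    subposet B'' B & subposet B'' B'].
Proof.
move=> [S sS <-] [T sT <-] Sp Tp.
have [G [oG Gp sG leG GST]] := lift_set_meet sS sT Sp Tp.
exists (lift (induced S G)); split; first by exists (induced S G).
- exact/lift_set_induced.
- split=> [q /lift_set_induced[]//|q r Sq Sr].
  have [Sq' Gq] := (lift_set_induced S q oG).1 Sq.
  have [Sr' Gr] := (lift_set_induced S r oG).1 Sr.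
  by split=> [[_ _ [_ _ ?]]|[_ _ ?]].
- split=> [q /lift_set_induced[]// Sq Gq|q r Sq Sr]; first exact: GST.
  have [Sq' Gq] := (lift_set_induced S q oG).1 Sq.
  have [Sr' Gr] := (lift_set_induced S r oG).1 Sr.
  split=> [[_ _ [_ _ /(leG _ _ Gq Gr) ?]]|[_ _ /(leG _ _ Gq Gr) ?]].
    by split=> //; exact: GST.
  by split.
Qed.

Definition etale_order : local_order := LocalOrder etale_basis etale_compat.

Lemma lift_ordered_open S : slice S -> @ordered_open etale_order (lift S).
Proof. by move=> sS; apply: ordered_open_base; exists S. Qed.

Lemma pt_continuous : continuous (pt : etale -> X).
Proof.
move=> p W pW; have [S sS Sp] := lift_set_exists p.
have [T [sT Tp TW]] := lift_set_shrink sS Sp pW.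
by apply: filterS TW (nbhs_lift sT Tp).
Qed.

Lemma pt_order_map S : order_map (lift S) S (pt : etale -> X).
Proof.
split; first exact/continuous_subspaceT/pt_continuous.
by split=> [_ [p [Sp _] <-]//|p q []].
Qed.

(** The inverse of [pt] on a lift sends a point of [S] to the germ of [S] there.
    It has to be total, and [p0] only supplies its values outside [S]. *)
Lemma lift_section S (p0 : etale) : slice S -> exists s : X -> etale,
  [/\ order_map S (lift S) s, forall y, carrier S y -> pt (s y) = y &
    forall p, lift_set S p -> s (pt p) = p].
Proof.
move=> sS.
have [s sP] : {s : X -> etale & forall y, carrier S y ->
    pt (s y) = y /\ lift_set S (s y)}.
  apply: (@choice _ _ (fun y p => carrier S y -> pt p = y /\ lift_set S p)).
  move=> y.
  have [Sy|nSy] := pselect (carrier S y); last by exists p0.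
  have yP : exists T, [/\ slice T, carrier T y &
    germ y (carrier S) = germ y (carrier T)] by exists S.
  by exists (Etale yP).
have sS' y : carrier S y -> lift_set S (s y) by move=> /sP[].
have sK y : carrier S y -> pt (s y) = y by move=> /sP[].
exists s; split=> //.
- split; last first.
    split=> [_ [y Sy <-]|y z yz]; first exact: sS'.
    have [Sy Sz] := ple_carrier yz.
    by split; [exact: sS'|exact: sS'|rewrite !sK].
  apply/subspace_continuousP => y Sy N /= /nbhs_etaleP[T [sT Tp TN]].
  have [G [oG Gp _ _ GST]] := lift_set_meet sS sT (sS' _ Sy) Tp.
  rewrite sK// in Gp.
  rewrite /nbhs /= /within /=.
  apply: filterS (open_nbhs_nbhs (conj oG Gp)) => z Gz Sz.
  by apply/TN/GST; [rewrite sK|exact: sS'].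
- move=> p [Sp Gp]; apply: etale_eq; first exact: sK.
  by rewrite (sS' _ Sp).2 sK// Gp.
Qed.

Lemma etale_euclidean : euclidean R n etale_order.
Proof.
move=> p; have [S sS Sp] := lift_set_exists p.
exists (lift S); split; first by split=> //; exact: lift_ordered_open.
apply: dihomeomorphic_trans sS.2.
have [s [sm sK Ks]] := lift_section p sS.
by exists pt, s; split=> //; exact: pt_order_map.
Qed.

Lemma pt_local_embedding : local_embedding (pt : etale_order -> X).
Proof.
apply: local_embedding_of_embeds; first exact: pt_continuous.
move=> p; have [S sS Sp] := lift_set_exists p.
have [[V oV [SV leV]] _] := sS.
have [s [sm sK Ks]] := lift_section p sS.
exists (lift S), V; split.
- by split=> //; exact: lift_ordered_open.
- by split=> //; exact: SV _ Sp.1.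
- split.
    split=> [_ [q Sq <-]|q r [[Sq _] [Sr _] qr]]; first exact: SV _ Sq.1.
    by apply/leV.
  exists s; split=> [|q Sq]; last exact: Ks.
  have -> : s = s \o id by [].
  apply: order_map_comp sm _; split.
    by apply: continuous_subspaceT => y; exact: cvg_id.
  split=> [_ [_ [_ [q [Sq _] <-]] <-]//|_ _ [[q [Sq _] <-] [r [Sr _] <-] qr]].
  exact/leV.
Qed.
End Slices.
Arguments pt {R n X}.


(** * Lifting local embeddings *)

Section Invariance.
Variables (R : realType) (n : nat) (X Y : topologicalType).

(** Invariance of domain for order embeddings, transported from R^n to
    arbitrary copies of R^n. *)
Lemma order_reflecting_image_open (U : poset_in X) (T : poset_in Y)
    (g : X -> Y) :
  dihomeomorphic U (euclidean_space R n) ->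
  dihomeomorphic T (euclidean_space R n) ->
  order_map U T g ->
  (forall u v, carrier U u -> carrier U v -> ple T (g u) (g v) -> ple U u v) ->
  exists2 W, open W & forall y, carrier T y -> (W y <-> (g @` carrier U) y).
Proof.
move=> [a [b [am bm aK bK]]] [c [d [cm dm cK dK]]] gm gr.
pose F := c \o g \o b.
have Fm : order_map (euclidean_space R n) (euclidean_space R n) F.
  by apply: order_map_comp bm; exact: order_map_comp gm.
have bU v : carrier U (b v) by apply: bm.2.1; exists v.
have gT u : carrier U u -> carrier T (g u).
  by move=> Uu; apply: gm.2.1; exists u.
have Fc : continuous F.
  by move=> v; have := Fm.1 v; rewrite /continuous_at (nbhs_subspaceT v).
have FE : order_embedding F.
  move=> v w; split=> [vw|]; last exact: Fm.2.2.
  rewrite -[v]bK// -[w]bK//; apply/am.2.2/gr => //.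
  by rewrite -(cK _ (gT _ (bU v))) -(cK _ (gT _ (bU w))); exact: dm.2.2.
have [W oW WE] := within_continuous_open cm.1 (order_embedding_open Fc FE).
exists W => // y Ty; apply: iff_trans (WE y Ty) _; split=> [[v _ Fv]|[u Uu <-]].
  by exists (b v) => //; rewrite -[y]cK// -Fv /F /= cK//; exact: gT.
by exists (a u) => //; rewrite /F /= aK.
Qed.
End Invariance.

Section Charts.
Variables (R : realType) (n : nat) (E X : local_order) (g : E -> X).

(** The neighborhoods on which the lift of [g] can be described: [g] is a
    dihomeomorphism from [U] onto the slice [S]. *)
Definition chart (U : poset_in E) (S : poset_in X) : Prop :=
  [/\ ordered_open U, slice R n S, carrier S = g @` carrier U, order_map U S g &
    exists g' : X -> E, order_map S U g' /\
      forall u, carrier U u -> g' (g u) = u].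

(** The overlap of [U] and [U'] is open in each of them, hence its image is open
    both in [S] and in [S']. *)
Lemma chart_agree U S U' S' e : chart U S -> chart U' S' ->
  carrier U e -> carrier U' e ->
  germ (g e) (carrier S) = germ (g e) (carrier S').
Proof.
have sub V T V' T' : chart V T -> chart V' T' -> carrier V e -> carrier V' e ->
    \forall y \near g e, carrier T y -> carrier T' y.
  move=> [[oV _] _ TE _ [g' [[g'c _] g'K]]] [[oV' _] _ T'E _ _] Ve V'e.
  have [W oW WE] := within_continuous_open g'c oV'.
  have We : W (g e) by apply/WE; [rewrite TE; exists e|rewrite g'K].
  apply: filterS (open_nbhs_nbhs (conj oW We)) => y Wy Ty.
  have := (WE y Ty).1 Wy; rewrite TE in Ty; have [u Vu <-] := Ty.
  by rewrite g'K// T'E => V'u; exists u.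
move=> c c' Ue U'e; apply/germP.
by apply: filterS2 (sub _ _ _ _ c c' Ue U'e) (sub _ _ _ _ c' c U'e Ue).
Qed.

Hypothesis gE : local_embedding g.
Hypothesis EE : euclidean R n E.

(** The chart is taken inside a prescribed ordered neighborhood [N], with the
    order of [N]; [lift_in_chart] needs this to compare the given charts of [g]
    with the neighborhoods on which another map is an embedding. *)
Lemma chart_exists e N : ordered_nbhd e N ->
  exists U S, [/\ chart U S, carrier U e & subposet U N].
Proof.
move=> eN; have [U0 [eU0 U0R]] := EE e.
have [V eV] := ordered_nbhd_exists (g e).
have [U1 [eU1 gm gemb]] := gE.2 e V eV.
have [W0 [oW0 W0e sW0 leW0]] := ordered_nbhd_agree eU0 eU1.
have [W1 [oW1 W1e sW1 leW1]] := ordered_nbhd_agree eU0 eN.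
have [G [oG Ge GW GR]] := dihomeomorphic_shrink U0R eU0.2
  (open_nbhs_nbhs (conj (openI oW0 oW1) (conj W0e W1e))).
pose U := induced U0 G.
have UN : subposet U N.
  split=> [x [_ /GW[_ /sW1[]]]//|x y [_ Gx] [_ Gy]].
  have [_ Wx] := GW _ Gx; have [_ Wy] := GW _ Gy.
  by split=> [[_ _ /(leW1 _ _ Wx Wy)]|/(leW1 _ _ Wx Wy)].
have UU1 : subposet U U1.
  split=> [x [_ /GW[/sW0[]]]//|x y [_ Gx] [_ Gy]].
  have [Wx _] := GW _ Gx; have [Wy _] := GW _ Gy.
  by split=> [[_ _ /(leW0 _ _ Wx Wy)]|/(leW0 _ _ Wx Wy)].
have [[gUV gle] [g' [g'm g'K]]] := embeds_subposet UU1 (conj gm gemb).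
pose S := induced V (g @` carrier U).
have SE : carrier S = g @` carrier U.
  by apply/seteqP; split=> [y []//|y Uy]; split=> //; exact: gUV.
have gUS : order_map U S g.
  split; first exact: continuous_subspaceT gE.1.
  split=> [|x y xy]; first by rewrite SE.
  have [Ux Uy] := ple_carrier xy.
  by split; [exists x|exists y|exact: gle].
exists U, S; split=> //; last by split=> //; exact: eU0.2.
split=> //.
- exact: ordered_open_induced eU0.1 oG.
- split.
    exists V; first exact: eV.1.
    split=> [y []//|x y [_ Sx] [_ Sy]]; by split=> [[]|].
  apply: dihomeomorphic_trans GR; exists g', g; split=> // y.
  by rewrite SE => -[u Uu <-]; rewrite g'K.
- by exists g'.
Qed.

Lemma lift_exists : exists h : E -> etale R n X,
  (forall e, pt (h e) = g e) /\
  forall e U S, chart U S -> carrier U e -> lift_set S (h e).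
Proof.
have [h hP] : {h : E -> etale R n X & forall e, pt (h e) = g e /\
    forall U S, chart U S -> carrier U e -> lift_set S (h e)}.
  apply: (@choice _ _ (fun e p => pt p = g e /\
    forall U S, chart U S -> carrier U e -> lift_set S p)) => e.
  have [N eN] := ordered_nbhd_exists e.
  have [U [S [c Ue _]]] := chart_exists eN.
  have eP : exists T, [/\ slice R n T, carrier T (g e) &
      germ (g e) (carrier S) = germ (g e) (carrier T)].
    by case: c => [_ sS SE _ _]; exists S; split=> //; rewrite SE; exists e.
  exists (Etale eP); split=> // U' S' c' U'e; split=> /=.
    by case: c' => [_ _ -> _ _]; exists e.
  exact: chart_agree c c' Ue U'e.
by exists h; split=> [e|e U S c Ue]; [exact: (hP e).1|exact: (hP e).2 c Ue].
Qed.

Lemma lift_local_embedding (h : E -> etale_order R n X) :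
  (forall e, pt (h e) = g e) ->
  (forall e U S, chart U S -> carrier U e -> lift_set S (h e)) ->
  local_embedding h.
Proof.
move=> hg hS.
have hm U S e : chart U S -> carrier U e -> order_map U (lift R n S) h.
  move=> c Ue; have [_ sS _ gm _] := c.
  have [s [sm sK Ks]] := lift_section (h e) sS.
  have [sgc [sgU sgle]] := order_map_comp sm gm.
  have hsg u : carrier U u -> s (g u) = h u.
    by move=> Uu; rewrite -hg Ks//; exact: hS c Uu.
  split; last split.
  - by apply: subspace_eq_continuous sgc => u /set_mem /hsg.
  - by move=> _ [u Uu <-]; exact: hS c Uu.
  - move=> u v uv; have [Uu Uv] := ple_carrier uv.
    by rewrite -!hsg//; exact: sgle.
have ch e : exists U S, chart U S /\ carrier U e.
  have [N eN] := ordered_nbhd_exists e.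
  by have [U [S [c Ue _]]] := chart_exists eN; exists U, S.
apply: local_embedding_of_embeds => [e|e].
  have [U [S [c Ue]]] := ch e; have [[oU _] _ _ _ _] := c.
  have := (hm _ _ _ c Ue).1; rewrite continuous_open_subspace// => hc.
  by apply: hc; exact: mem_set.
have [U [S [c Ue]]] := ch e; have [oU sS _ _ [g' [g'm g'K]]] := c.
exists U, (lift R n S); split.
- by split.
- by split; [exact: lift_ordered_open|exact: hS c Ue].
- split; first exact: (hm _ _ _ c Ue).2.
  exists (g' \o pt); split; last by move=> u Uu /=; rewrite hg g'K.
  have [mc [mU mle]] := order_map_comp g'm (pt_order_map R n S).
  split; first by apply: continuous_subspaceW mc => p [].
  split=> [_ [p [Sp _] <-]|p q [_ _ pq]]; last exact: mle.
  by apply: mU; exists p.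
Qed.

(** The uniqueness of lifts. A lift [h] maps a neighborhood of [e] into the lift
    of some slice [T], so that [g] embeds a chart [U] at [e] into [T]. As both
    are copies of R^n, the image [S] of [U] is open in [T], hence [S] and [T]
    have the same germ at [g e]. *)
Lemma lift_in_chart (h : E -> etale_order R n X) :
  local_embedding h -> (forall e, pt (h e) = g e) ->
  forall e, exists U S, [/\ chart U S, carrier U e & lift_set S (h e)].
Proof.
move=> [_ hE] hg e.
have [T sT Te] := lift_set_exists (h e).
have [|U1 [eU1 hm hemb]] := hE e (lift R n T).
  by split=> //; exact: lift_ordered_open.
have [U [S [c Ue UU1]]] := chart_exists eU1.
have [hUT [h' [h'm h'K]]] := embeds_subposet UU1 (conj hm hemb).
have [oU sS SE gm [g' [g'm g'K]]] := c.
exists U, S; split=> //.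
have gT u : carrier U u -> carrier T (g u).
  move=> Uu; rewrite -hg; suff [] : lift_set T (h u) by [].
  by apply: hUT.1; exists u.
have gTm : order_map U T g.
  split; first exact: gm.1.
  split=> [_ [u Uu <-]|u v uv]; first exact: gT.
  by have [_ _] := hUT.2 _ _ uv; rewrite !hg.
have [||W oW WE] := @order_reflecting_image_open R n _ _ U T g _ sT.2 gTm.
- by apply: dihomeomorphic_trans sS.2; exists g, g'; split=> // y;
    rewrite SE => -[u Uu <-]; rewrite g'K.
- move=> u v Uu Uv uv; rewrite -(h'K u)// -(h'K v)//; apply: h'm.2.2.
  split; [by exists u|by exists v|split].
  + by apply: hUT.1; exists u.
  + by apply: hUT.1; exists v.
  + by rewrite !hg.
split; rewrite hg; first by rewrite SE; exists e.
rewrite Te.2 hg.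
have We : W (g e) by apply/WE; [exact: gT|exists e].
apply: (germ_eq_on oW We) => y Wy; rewrite SE; split=> [Ty|[u Uu <-]].
  exact: (WE y Ty).1.
exact: gT.
Qed.
End Charts.

Theorem etale_universal (R : realType) (n : nat) (E X : local_order)
    (g : E -> X) :
  euclidean R n E -> local_embedding g ->
  exists h : E -> etale_order R n X,
    [/\ local_embedding h, pt \o h = g &
      forall k : E -> etale_order R n X, local_embedding k ->
        pt \o k = g -> k = h].
Proof.
move=> EE gE; have [h [hg hS]] := lift_exists gE EE.
exists h; split; first exact: lift_local_embedding gE EE _ hg hS.
  exact/funext.
move=> k kE kg; have kg' e : pt (k e) = g e by rewrite -kg.
apply/funext => e; have [U [S [c Ue [Se Gk]]]] := lift_in_chart gE EE kE kg' e.
have [_ Gh] := hS _ _ _ c Ue.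
by apply: etale_eq; rewrite ?Gk ?Gh ?kg' ?hg.
Qed.

(** * The coreflections *)

Section Adjoint.
Variables (C D : category) (F : functor C D).

Lemma right_adjoint_of_universal_arrows :
  (forall d : D, exists (g : C) (eps : hom (F g) d),
    forall (c : C) (u : hom (F c) d),
      exists! h : hom c g, comp eps (fmap F h) = u) ->
  has_right_adjoint F.
Proof.
move=> univ.
have [G /all_sig[eps epsP]] : {G : D -> C & forall d, {eps : hom (F (G d)) d |
    forall (c : C) (u : hom (F c) d), exists! h, comp eps (fmap F h) = u}}.
  have H d : {g : C & {eps : hom (F g) d |
      forall (c : C) (u : hom (F c) d), exists! h, comp eps (fmap F h) = u}}.
    by have [g gP] := cid (univ d); exists g; have [e eP] := cid gP; exists e.
  by exists (fun d => projT1 (H d)) => d; exact: projT2 (H d).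
have tP c d (u : hom (F c) d) : {h : hom c (G d) | comp (eps d) (fmap F h) = u}.
  by have [h [hu _]] := cid (epsP d c u); exists h.
pose t c d (u : hom (F c) d) : hom c (G d) := sval (tP c d u).
have tE c d (u : hom (F c) d) : comp (eps d) (fmap F (t c d u)) = u.
  exact: svalP (tP c d u).
have uniq c d (h k : hom c (G d)) :
    comp (eps d) (fmap F h) = comp (eps d) (fmap F k) -> h = k.
  move=> hk; have [m [_ mu]] := epsP d c (comp (eps d) (fmap F k)).
  by rewrite -(mu h hk) -(mu k erefl).
pose Gm d d' (k : hom d d') : hom (G d) (G d') := t _ _ (comp k (eps d)).
have GmE d d' (k : hom d d') :
    comp (eps d') (fmap F (Gm d d' k)) = comp k (eps d).
  exact: tE.
have Gid d : Gm d d (idm d) = idm (G d).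
  by apply: uniq; rewrite GmE comp_idl fmap_id comp_idr.
have Gcomp d d' d'' (k : hom d' d'') (l : hom d d') :
    Gm d d'' (comp k l) = comp (Gm d' d'' k) (Gm d d' l).
  apply: uniq; rewrite GmE fmap_comp comp_assoc GmE.
  by rewrite -[RHS]comp_assoc GmE comp_assoc.
exists (@Functor D C G Gm Gid Gcomp); constructor.
apply: (@Adjunction _ _ F (@Functor D C G Gm Gid Gcomp) t) => [c d|].
  exists (fun h => comp (eps d) (fmap F h)) => [u|h]; first exact: tE.
  by apply: uniq; rewrite tE.
move=> c c' d d' h u k /=; apply: uniq.
rewrite tE !fmap_comp [RHS]comp_assoc GmE -[RHS]comp_assoc.
by rewrite (comp_assoc (eps d)) tE.
Qed.
End Adjoint.

Lemma local_embedding_morphism (X Y : local_order) (f : X -> Y) :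
  local_embedding f -> lo_morphism f.
Proof.
move=> [fc fE]; split=> // x V Vx.
by have [U [Ux fUV _]] := fE x V Vx; exists U.
Qed.

(** Both target categories contain all local embeddings, and have no other map
    with euclidean domain; the coreflection depends on nothing else. *)
Section Coreflection.
Variables (R : realType) (n : nat) (T : subcategory LO).
Hypothesis T_obj : forall X : LO, sub_obj T X.
Hypothesis T_local_embedding : forall (X Y : LO) (f : hom X Y),
  local_embedding (sval f) -> sub_hom T f.
Hypothesis local_embedding_T : forall (X Y : LO) (f : hom X Y),
  euclidean R n X -> sub_hom T f -> local_embedding (sval f).

Lemma eucl_coreflective : coreflective (Eucl R n) T.
Proof.
have ST : subcat_le (Eucl R n) T.
  by split=> [X _|X Y f _ _]; [exact: T_obj|exact: T_local_embedding].
exists ST; split.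
  move=> X Y [g gT]; have gE := local_embedding_T (svalP X) gT.
  by exists (exist _ g gE); exact: sig_eq.
apply: right_adjoint_of_universal_arrows => X.
pose EX : subcat (Eucl R n) :=
  exist _ (etale_order R n (sval X) : LO) (@etale_euclidean R n (sval X)).
have ptE := @pt_local_embedding R n (sval X).
pose eps : hom (etale_order R n (sval X) : LO) (sval X) :=
  exist _ (pt : etale_order R n (sval X) -> sval X)
    (local_embedding_morphism ptE).
have epsT : sub_hom T eps by exact: T_local_embedding.
exists EX, (exist _ eps epsT) => E [u uT].
have uE := local_embedding_T (svalP E) uT.
have [h [hE hu hU]] := etale_universal (svalP E) uE.
pose h' : hom (sval E) (sval EX) := exist _ h (local_embedding_morphism hE).
exists (exist _ h' hE).
split; first by apply/sig_eq/sig_eq.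
move=> [[k km] kE] ku; apply/sig_eq/sig_eq => /=; apply/esym/hU => //.
by have /(congr1 (fun f => sval (sval f))) := ku.
Qed.
End Coreflection.

Theorem corollary4p12 (R : realType) (n : nat) :
  coreflective (Eucl R n) (LOwe R n) /\ coreflective (Eucl R n) LOe.
Proof.
split; apply: eucl_coreflective => //.
- move=> X Y f fE; split; first exact: svalP f.
  by move=> E g _ gE; exact: local_embedding_comp.
- by move=> X Y f XE [_ /(_ X idfun XE (local_embedding_id X))].
Qed.
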